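(* Let $M$ be an $R$-module and let $t\in MT_3(M)$ be such that $t$ factorizes through $\widetilde{BMW}_3$. (1) The trace $t$ is uniquely determined by $t(1)$, $t(s_1)=t(s_2)$ and $t(s_1s_2)$. (2) If $x(a^2-y^2)$ is invertible in $M$, then $t$ is uniquely determined by $t(1)$ and $t(s_1s_2)$. (3) If $x^2(a^2-y)$ is invertible in $M$, then $t$ is uniquely determined by $t(s_1)$ and $t(s_1s_2)$. (4) If $x(a^2-y^2)$ and $x^2(a^2-y)$ are invertible in $M$, then $t$ is uniquely determined by $t(s_1s_2)$.
   Context: $R=\mathbb{Q}[a,b,c,(abc)^{-1}]$, $x=b+c$, $y=bc$. $H_n$ is the quotient of the group algebra $RB_n$ of the braid group (Artin generators $s_1,\dots,s_{n-1}$) by the relations $(s_i-a)(s_i-b)(s_i-c)=0$. $\widetilde{BMW}_3$ is the quotient of $H_3$ by the two-sided ideal generated by $$\mathcal{R}_1=-y\,s_1s_2^{-1}s_1+y^2s_2^{-1}s_1s_2^{-1}-s_1s_2s_1-xy^2s_2^{-2}+x\,s_1^2+y^3s_2^{-1}s_1^{-1}s_2^{-1}.$$ For an $R$-module $M$, $MT_3(M)$ is the $R$-module of $R$-linear maps $t:H_3\to M$ such that $t(uv)=t(vu)$ for all $u,v\in H_3$ and $t(us_2)=t(us_2^{-1})$ for all $u$ in the image of $H_2\to H_3$. ''An element $r\in R$ is invertible in $M$'' means that multiplication by $r$ is bijective on $M$. ''$t$ is uniquely determined by certain values'' means that two such traces (elements of $MT_3(M)$ factorizing through $\widetilde{BMW}_3$)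 with the same such values are equal. *)

(* Defs.v *)
From HB Require Import structures.
From mathcomp Require Import all_boot all_order all_algebra.
From mathcomp Require Import finmap boolp.
From mathcomp Require Import mpoly.

Set Implicit Arguments.
Unset Strict Implicit.
Unset Printing Implicit Defensive.

Import GRing.Theory.

Local Open Scope ring_scope.
Local Open Scope quotient_scope.

Definition Qabc_frac := {fraction {mpoly rat[3]}}.

Definition abc_frac : Qabc_frac := \prod_(i < 3) tofrac 'X_i.

(* The localisation of Q[a, b, c] at the powers of abc, realised inside the
   field of fractions. *)
Definition in_Rabc : {pred Qabc_frac} :=
  fun f => `[< exists (p : {mpoly rat[3]}) (k : nat),
                 f = tofrac p / abc_frac ^+ k >].

Lemma abc_frac_neq0 : abc_frac != 0.
Proof.
apply/prodf_neq0 => i _; rewrite tofrac_eq0; apply/eqP => /(congr1 (mcoeff U_(i))).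
by rewrite mcoeffX eqxx mcoeff0 => /eqP; rewrite oner_eq0.
Qed.

Lemma in_Rabc_subring : subring_closed in_Rabc.
Proof.
have n0 k : abc_frac ^+ k != 0 by rewrite expf_neq0 ?abc_frac_neq0.
have qE : abc_frac = tofrac (\prod_(i < 3) 'X_i) by rewrite rmorph_prod.
split.
- by apply/asboolP; exists 1, 0%N; rewrite expr0 divr1 rmorph1.
- move=> _ _ /asboolP[p [k ->]] /asboolP[p' [k' ->]]; apply/asboolP.
  exists (p * (\prod_(i < 3) 'X_i) ^+ k' - p' * (\prod_(i < 3) 'X_i) ^+ k).
  exists (k + k')%N.
  rewrite rmorphB !rmorphM !rmorphXn /= -qE exprD mulrBl.
  rewrite -mulf_div divff // mulr1 (mulrC (abc_frac ^+ k)).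
  by rewrite -mulf_div divff // mulr1.
- move=> _ _ /asboolP[p [k ->]] /asboolP[p' [k' ->]]; apply/asboolP.
  exists (p * p'), (k + k')%N.
  by rewrite rmorphM exprD mulf_div.
Qed.

HB.instance Definition _ :=
  GRing.isSubringClosed.Build Qabc_frac in_Rabc in_Rabc_subring.

Record Rabc : predArgType :=
  MkRabc {Rabc_val :> Qabc_frac; _ : in_Rabc Rabc_val}.

HB.instance Definition _ := [isSub for Rabc_val].
HB.instance Definition _ := [Choice of Rabc by <:].
HB.instance Definition _ := [SubChoice_isSubComNzRing of Rabc by <:].

Lemma in_Rabc_var (i : 'I_3) : in_Rabc (tofrac 'X_i).
Proof. by apply/asboolP; exists 'X_i, 0%N; rewrite expr0 divr1. Qed.

HB.lock Definition Ra : Rabc := MkRabc (in_Rabc_var (inord 0)).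
HB.lock Definition Rb : Rabc := MkRabc (in_Rabc_var (inord 1)).
HB.lock Definition Rc : Rabc := MkRabc (in_Rabc_var (inord 2)).
Definition Rx : Rabc := Rb + Rc.
Definition Ry : Rabc := Rb * Rc.

Lemma Rabc_inv_subproof : in_Rabc abc_frac^-1.
Proof. by apply/asboolP; exists 1, 1%N; rewrite rmorph1 expr1 mul1r. Qed.

Definition Rabc_inv : Rabc := MkRabc Rabc_inv_subproof.

Lemma Rabc_invP : Ra * Rb * Rc * Rabc_inv = 1.
Proof.
apply/val_inj; rewrite Ra.unlock Rb.unlock Rc.unlock !rmorphM rmorph1 /=.
have -> : tofrac 'X_(inord 0) * tofrac 'X_(inord 1) * tofrac 'X_(inord 2)
          = abc_frac.
  rewrite /abc_frac !big_ord_recl big_ord0 mulr1 mulrA.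
  by congr (tofrac 'X_ _ * tofrac 'X_ _ * tofrac 'X_ _);
    apply/val_inj; rewrite /= inordK.
by rewrite mulfV ?abc_frac_neq0.
Qed.

Section PresentedGroup.
Variables (I : choiceType).

(* The letter (i, true) is the generator i and (i, false) its inverse. *)
Definition word : Type := seq (I * bool).
HB.instance Definition _ := Choice.on word.

Variable rel : word -> word -> Prop.

Inductive pres_eq : word -> word -> Prop :=
| pres_refl u : pres_eq u u
| pres_sym u v : pres_eq u v -> pres_eq v u
| pres_trans u v w : pres_eq u v -> pres_eq v w -> pres_eq u w
| pres_cat u u' v v' :
    pres_eq u u' -> pres_eq v v' -> pres_eq (u ++ v) (u' ++ v')
| pres_cancel i e : pres_eq [:: (i, e); (i, ~~ e)] [::]
| pres_rel u v : rel u v -> pres_eq u v.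

Definition pres_eqb (u v : word) : bool := `[< pres_eq u v >].

Lemma pres_eqb_equiv : equiv_class_of pres_eqb.
Proof.
split=> [u|u v|v u w].
- by apply/asboolP; apply: pres_refl.
- by apply/asboolP/asboolP => /pres_sym.
- by move=> /asboolP h /asboolP h'; apply/asboolP; apply: pres_trans h h'.
Qed.

Canonical pres_eqb_equivrel := EquivRelPack pres_eqb_equiv.
Canonical pres_eqb_encModRel := defaultEncModRel pres_eqb.

Definition pres_group := {eq_quot pres_eqb}.
HB.instance Definition _ : EqQuotient word pres_eqb pres_group :=
  EqQuotient.on pres_group.
HB.instance Definition _ := Choice.on pres_group.

Definition winv (u : word) : word := rev [seq (l.1, ~~ l.2) | l <- u].

Definition pres_one : pres_group := \pi_pres_group ([::] : word).
Definition pres_mul (g h : pres_group) : pres_group :=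
  \pi_pres_group (repr g ++ repr h : word).
Definition pres_inv (g : pres_group) : pres_group :=
  \pi_pres_group (winv (repr g)).

Lemma pres_piP (u v : word) :
  pres_eq u v <-> \pi_pres_group u = \pi_pres_group v.
Proof.
by split=> [h|/eqP]; [apply/eqP; rewrite piE; apply/asboolP
                     | rewrite piE => /asboolP].
Qed.

Lemma pres_reprK (u : word) : pres_eq (repr (\pi_pres_group u)) u.
Proof. by apply/pres_piP; rewrite reprK. Qed.

Lemma winvK : involutive winv.
Proof.
move=> u; rewrite /winv map_rev revK -map_comp map_id_in // => -[i e] _ /=.
by rewrite negbK.
Qed.

Lemma winv_cat u v : winv (u ++ v) = winv v ++ winv u.
Proof. by rewrite /winv map_cat rev_cat. Qed.

Lemma winvr u : pres_eq (u ++ winv u) [::].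
Proof.
elim: u => [|[i e] u IH]; first exact: pres_refl.
have -> : ((i, e) :: u) ++ winv ((i, e) :: u)
    = [:: (i, e)] ++ ((u ++ winv u) ++ [:: (i, ~~ e)]) :> word.
  by rewrite -[(i, e) :: u]cat1s winv_cat -!catA.
apply: pres_trans (pres_cancel i e).
apply: (@pres_cat _ [:: (i, e)] _ [:: (i, ~~ e)]); first exact: pres_refl.
exact: (@pres_cat _ [::] _ [:: (i, ~~ e)] IH (pres_refl _)).
Qed.

Lemma winvl u : pres_eq (winv u ++ u) [::].
Proof. by rewrite -{2}[u]winvK; apply: winvr. Qed.

Lemma winv_eq u v : pres_eq u v -> pres_eq (winv u) (winv v).
Proof.
move=> h; apply: (@pres_trans _ (winv u ++ (v ++ winv v))).
  rewrite -[X in pres_eq X _]cats0; apply: pres_cat (pres_refl _) _.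
  exact/pres_sym/winvr.
rewrite catA -[X in pres_eq _ X]cat0s; apply: pres_cat (pres_refl _).
apply: pres_trans (winvl u); apply: pres_cat (pres_refl _) _.
exact: pres_sym.
Qed.

Lemma pi_pres_mul (u v : word) :
  pres_mul (\pi u) (\pi v) = \pi_pres_group (u ++ v : word).
Proof. by apply/pres_piP; apply: pres_cat; apply: pres_reprK. Qed.

Lemma pi_pres_inv (u : word) : pres_inv (\pi u) = \pi_pres_group (winv u).
Proof. exact/pres_piP/winv_eq/pres_reprK. Qed.

Lemma pres_mulA : associative pres_mul.
Proof.
by elim/quotW=> u; elim/quotW=> v; elim/quotW=> w; rewrite !pi_pres_mul catA.
Qed.

Lemma pres_mul1g : left_id pres_one pres_mul.
Proof. by elim/quotW=> u; rewrite pi_pres_mul. Qed.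

Lemma pres_mulg1 : right_id pres_one pres_mul.
Proof. by elim/quotW=> u; rewrite pi_pres_mul cats0. Qed.

Lemma pres_mulVg : left_inverse pres_one pres_inv pres_mul.
Proof.
by elim/quotW=> u; rewrite pi_pres_inv pi_pres_mul; apply/pres_piP/winvl.
Qed.

Lemma pres_mulgV : right_inverse pres_one pres_inv pres_mul.
Proof.
by elim/quotW=> u; rewrite pi_pres_inv pi_pres_mul; apply/pres_piP/winvr.
Qed.

HB.instance Definition _ := isGroup.Build pres_group
  pres_mulA pres_mul1g pres_mulg1 pres_mulVg pres_mulgV.

Definition pres_gen (i : I) : pres_group :=
  \pi_pres_group ([:: (i, true)] : word).

Lemma pres_genV i : (pres_gen i)^-1%g = \pi_pres_group ([:: (i, false)] : word).
Proof. exact: pi_pres_inv. Qed.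

Lemma pi_pres_cat u v :
  \pi_pres_group (u ++ v : word) = (\pi_pres_group u * \pi_pres_group v)%g.
Proof. exact/esym/pi_pres_mul. Qed.

End PresentedGroup.

Definition gword (I : Type) (w : seq I) : seq (I * bool) :=
  [seq (i, true) | i <- w].

(* The Artin generator s_(i+1) is the index i : 'I_n.-1. *)
Inductive braid_rel (n : nat) : word 'I_n.-1 -> word 'I_n.-1 -> Prop :=
| braid_rel3 (i j : 'I_n.-1) : j = i.+1 :> nat ->
    braid_rel (gword [:: i; j; i]) (gword [:: j; i; j])
| braid_relC (i j : 'I_n.-1) : (i.+1 < j)%N ->
    braid_rel (gword [:: i; j]) (gword [:: j; i]).

Definition braid (n : nat) := pres_group (@braid_rel n).
HB.instance Definition _ n := Group.on (braid n).

Definition braid_gen (n : nat) (i : 'I_n.-1) : braid n :=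
  pres_gen (@braid_rel n) i.

Lemma braid_rel3P n (i j : 'I_n.-1) : j = i.+1 :> nat ->
  (braid_gen i * braid_gen j * braid_gen i
   = braid_gen j * braid_gen i * braid_gen j)%g.
Proof.
move=> ij; have /pres_piP := pres_rel (braid_rel3 ij).
rewrite -[gword [:: i; j; i]]/([:: (i, true)] ++ [:: (j, true)] ++ [:: (i, true)]).
rewrite -[gword [:: j; i; j]]/([:: (j, true)] ++ [:: (i, true)] ++ [:: (j, true)]).
by rewrite !catA !pi_pres_cat.
Qed.

Lemma leq_pred2 m n : (m <= n)%N -> (m.-1 <= n.-1)%N.
Proof. by rewrite -!subn1; apply: leq_sub2r. Qed.

Section BraidWiden.
Variables (m n : nat) (le_mn : (m <= n)%N).

Definition letter_widen (l : 'I_m.-1 * bool) : 'I_n.-1 * bool :=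
  (widen_ord (leq_pred2 le_mn) l.1, l.2).

Definition braid_widen (g : braid m) : braid n :=
  \pi_(braid n) (map letter_widen (repr g) : word 'I_n.-1).

Lemma braid_widen_pi (u : word 'I_m.-1) :
  braid_widen (\pi u) = \pi_(braid n) (map letter_widen u : word _).
Proof.
apply/pres_piP; have := pres_reprK (@braid_rel m) u.
move: (repr _) => w; elim=> {u w} [u|u v _|u v w _ h _|u u' v v' _ h _ h'|i e|u v].
- exact: pres_refl.
- exact: pres_sym.
- exact: pres_trans h.
- by rewrite !map_cat; apply: pres_cat.
- exact: pres_cancel.
- by case=> i j ij; apply: pres_rel; constructor.
Qed.

Lemma braid_widenM : {morph braid_widen : g h / (g * h)%g}.
Proof.
elim/quotW=> u; elim/quotW=> v.
by rewrite -[(_ * _)%g]pi_pres_cat !braid_widen_pi map_cat -[RHS]pi_pres_cat.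
Qed.

Lemma braid_widen1 : braid_widen 1%g = 1%g.
Proof. exact: braid_widen_pi. Qed.

Lemma braid_widen_gen i :
  braid_widen (pres_gen (@braid_rel m) i)
  = pres_gen (@braid_rel n) (widen_ord (leq_pred2 le_mn) i).
Proof. exact: braid_widen_pi. Qed.

End BraidWiden.

(* Not imported above: monalg and mpoly define clashing {mpoly _[_]} notations. *)
From mathcomp Require Import monalg.

(* The ring structure that monalg puts on {malg R[K]} is restricted to monoids
   without nontrivial units, hence this copy for groups. *)
Definition galg (R : comNzRingType) (G : groupType) : Type := {malg R[G]}.
HB.instance Definition _ R G := GRing.Zmodule.on (galg R G).

Definition gmon (R : comNzRingType) (G : groupType) (x : R) (g : G) :
  galg R G :=
  << x *g g >>.

(* These operations and those of quotients below are locked, as unification failures otherwise unfold them down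
   to the operations of the coefficients. *)
HB.lock Definition galg_scale (R : comNzRingType) (G : groupType) (x : R)
  (u : galg R G) : galg R G := x *: (u : {malg R[G]}).
HB.lock Definition galg_mul (R : comNzRingType) (G : groupType)
  (u v : galg R G) : galg R G :=
  \sum_(g <- msupp u) \sum_(h <- msupp v)
    gmon (mcoeff g u * mcoeff h v) (g * h)%g.

Section GroupAlgebra.
Variables (R : comNzRingType) (G : groupType).
Local Open Scope fset.
Local Open Scope ring_scope.

Local Notation galg := (galg R G).
Local Notation gmon := (@gmon R G).
Local Notation galg_mul := (@galg_mul R G).
Local Notation galg_scale := (@galg_scale R G).
Implicit Types (x y z : R) (u v w : galg) (g h k : G).

Definition gbasis (g : G) : galg := gmon 1 g.

Fact galg_scaleA x y u : galg_scale x (galg_scale y u) = galg_scale (x * y) u.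
Proof. by rewrite galg_scale.unlock; apply: scalerA. Qed.

Fact galg_scale1 : left_id 1 galg_scale.
Proof. by rewrite galg_scale.unlock => u; apply: scale1r. Qed.

Fact galg_scaleDr : right_distributive galg_scale +%R.
Proof. by rewrite galg_scale.unlock => x u v; apply: scalerDr. Qed.

Fact galg_scaleDl u : {morph galg_scale^~ u : x y / x + y}.
Proof. by rewrite galg_scale.unlock => x y; apply: scalerDl. Qed.

HB.instance Definition _ := GRing.Zmodule_isLmodule.Build R galg
  galg_scaleA galg_scale1 galg_scaleDr galg_scaleDl.

Lemma mcoeff_scale x u g : mcoeff g (x *: u) = x * mcoeff g u.
Proof. by rewrite /GRing.scale /= galg_scale.unlock; apply: mcoeffZ. Qed.

Lemma gmonE x g h : mcoeff h (gmon x g) = x *+ (g == h).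
Proof. exact: mcoeffU. Qed.

Lemma gmonD g : {morph gmon^~ g : x y / x + y}.
Proof. by move=> x y; apply: monalgUD. Qed.

Lemma gmon0 g : gmon 0 g = 0.
Proof. exact: monalgU0. Qed.

Lemma gmonZ x y g : x *: gmon y g = gmon (x * y) g.
Proof. by apply/malgP=> h; rewrite mcoeff_scale !gmonE mulrnAr. Qed.

Lemma galgE u : u = \sum_(g <- msupp u) gmon (mcoeff g u) g.
Proof. exact: monalgE. Qed.

Lemma galg_ind (P : galg -> Prop) :
  P 0 -> (forall u v, P u -> P v -> P (u + v)) ->
  (forall x g, P (gmon x g)) -> forall u, P u.
Proof. by move=> P0 PD PU u; rewrite (galgE u); apply: big_ind. Qed.

Lemma galg_mulw (d1 d2 : {fset G}) u v :
  msupp u `<=` d1 -> msupp v `<=` d2 ->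
  galg_mul u v = \sum_(g <- d1) \sum_(h <- d2) gmon (mcoeff g u * mcoeff h v) (g * h)%g.
Proof.
move=> le1 le2; rewrite galg_mul.unlock (big_fset_incl _ le1) /=.
  apply/eq_bigr=> g _; apply/big_fset_incl => // h _ /mcoeff_outdom ->.
  by rewrite mulr0 gmon0.
move=> g _ /mcoeff_outdom ug.
by rewrite big1 => // h _; rewrite ug mul0r gmon0.
Qed.

Lemma galg_mulDl : left_distributive galg_mul +%R.
Proof.
have le u v : msupp (u + v : galg) `<=` msupp u `|` msupp v := msuppD_le u v.
move=> u v w; rewrite (galg_mulw (fsubsetUl (msupp u) (msupp v)) (fsubset_refl (msupp w))).
rewrite (galg_mulw (fsubsetUr (msupp u) (msupp v)) (fsubset_refl (msupp w))).
rewrite (galg_mulw (le u v) (fsubset_refl (msupp w))).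
rewrite -big_split /=; apply/eq_bigr=> g _.
rewrite -big_split /=; apply/eq_bigr=> h _.
by rewrite mcoeffD mulrDl gmonD.
Qed.

Lemma galg_mulDr : right_distributive galg_mul +%R.
Proof.
have le u v : msupp (u + v : galg) `<=` msupp u `|` msupp v := msuppD_le u v.
move=> w u v; rewrite (galg_mulw (fsubset_refl (msupp w)) (fsubsetUl (msupp u) (msupp v))).
rewrite (galg_mulw (fsubset_refl (msupp w)) (fsubsetUr (msupp u) (msupp v))).
rewrite (galg_mulw (fsubset_refl (msupp w)) (le u v)).
rewrite -big_split /=; apply/eq_bigr=> g _.
rewrite -big_split /=; apply/eq_bigr=> h _.
by rewrite mcoeffD mulrDr gmonD.
Qed.

Lemma galg_mulUU x y g h :
  galg_mul (gmon x g) (gmon y h) = gmon (x * y) (g * h)%g.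
Proof.
by rewrite (galg_mulw msuppU_le msuppU_le) !big_seq_fset1 !gmonE !eqxx.
Qed.

Lemma galg_mul0u : left_zero 0 galg_mul.
Proof. by move=> u; rewrite galg_mul.unlock msupp0 big_seq_fset0. Qed.

Lemma galg_mulu0 : right_zero 0 galg_mul.
Proof.
by move=> u; rewrite galg_mul.unlock big1 // => g _; rewrite msupp0 big_seq_fset0.
Qed.

Lemma galg_mulA : associative galg_mul.
Proof.
move=> u v w; elim/galg_ind: u => [|u u' IH IH'|x g].
- by rewrite !galg_mul0u.
- by rewrite !galg_mulDl IH IH'.
elim/galg_ind: v => [|v v' IH IH'|y h].
- by rewrite !(galg_mul0u, galg_mulu0).
- by rewrite !(galg_mulDl, galg_mulDr) IH IH'.
elim/galg_ind: w => [|w w' IH IH'|z k].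
- by rewrite !galg_mulu0.
- by rewrite !galg_mulDr IH IH'.
by rewrite !galg_mulUU mulrA mulgA.
Qed.

Lemma galg_mul1u : left_id (gbasis 1%g) galg_mul.
Proof.
elim/galg_ind=> [|v v' IH IH'|y h]; first by rewrite galg_mulu0.
  by rewrite galg_mulDr IH IH'.
by rewrite galg_mulUU mul1r mul1g.
Qed.

Lemma galg_mulu1 : right_id (gbasis 1%g) galg_mul.
Proof.
elim/galg_ind=> [|v v' IH IH'|y h]; first by rewrite galg_mul0u.
  by rewrite galg_mulDl IH IH'.
by rewrite galg_mulUU mulr1 mulg1.
Qed.

Lemma galg_oner_neq0 : gbasis 1%g != 0.
Proof.
apply/eqP => /malgP /(_ 1%g) /eqP.
by rewrite gmonE eqxx mcoeff0 oner_eq0.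
Qed.

HB.instance Definition _ := GRing.Zmodule_isNzRing.Build galg
  galg_mulA galg_mul1u galg_mulu1 galg_mulDl galg_mulDr galg_oner_neq0.

Lemma galg_mulE u v : u * v =
  \sum_(g <- msupp u) \sum_(h <- msupp v)
    gmon (mcoeff g u * mcoeff h v) (g * h)%g.
Proof. by rewrite [LHS]/GRing.mul /= galg_mul.unlock. Qed.

Lemma gmonM x y g h : gmon x g * gmon y h = gmon (x * y) (g * h)%g.
Proof. exact: galg_mulUU. Qed.

Lemma gbasisM g h : gbasis (g * h)%g = gbasis g * gbasis h.
Proof. by rewrite gmonM mulr1. Qed.

Lemma gbasis1 : gbasis 1%g = 1.
Proof. by []. Qed.

Lemma galg_scalerAl (x : R) u v : x *: (u * v) = (x *: u) * v.
Proof.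
elim/galg_ind: u => [|u u' IH IH'|y g]; first by rewrite !(mul0r, scaler0).
  by rewrite mulrDl !scalerDr mulrDl IH IH'.
elim/galg_ind: v => [|v v' IH IH'|z h]; first by rewrite !(mulr0, scaler0).
  by rewrite mulrDr !scalerDr mulrDr IH IH'.
by rewrite !(gmonM, gmonZ) mulrA.
Qed.

HB.instance Definition _ := GRing.Lmodule_isLalgebra.Build R galg galg_scalerAl.

Lemma galg_scalerAr (x : R) u v : x *: (u * v) = u * (x *: v).
Proof.
elim/galg_ind: u => [|u u' IH IH'|y g]; first by rewrite !(mul0r, scaler0).
  by rewrite mulrDl !scalerDr mulrDl IH IH'.
elim/galg_ind: v => [|v v' IH IH'|z h]; first by rewrite !(mulr0, scaler0).
  by rewrite mulrDr !scalerDr mulrDr IH IH'.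
by rewrite !(gmonM, gmonZ) mulrCA.
Qed.

HB.instance Definition _ := GRing.Lalgebra_isAlgebra.Build R galg galg_scalerAr.

End GroupAlgebra.

Section GroupAlgebraExtension.
Variables (R : comNzRingType) (G : groupType) (S : nzRingType).
Variables (phi : {rmorphism R -> S}) (f : G -> S).
Hypothesis f1 : f 1%g = 1.
Hypothesis fM : {morph f : g h / (g * h)%g >-> g * h}.
Hypothesis phiC : forall x s, GRing.comm (phi x) s.

Definition galg_lift (u : galg R G) : S := mmap phi f u.

Lemma galg_lift_gmon x g : galg_lift (gmon x g) = phi x * f g.
Proof. exact: mmapU. Qed.

Lemma galg_lift_zmod : zmod_morphism galg_lift.
Proof. by move=> u v; apply: (raddfB (mmap phi f)). Qed.

HB.instance Definition _ :=
  GRing.isZmodMorphism.Build (galg R G) S galg_lift galg_lift_zmod.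

Lemma galg_lift_monoid : monoid_morphism galg_lift.
Proof.
split; first by rewrite galg_lift_gmon rmorph1 mul1r.
move=> u v; elim/galg_ind: u => [|u u' IH IH'|x g].
- by rewrite !(mul0r, raddf0).
- by rewrite mulrDl !raddfD mulrDl /= IH IH'.
elim/galg_ind: v => [|v v' IH IH'|y h].
- by rewrite !(mulr0, raddf0).
- by rewrite mulrDr !raddfD mulrDr /= IH IH'.
rewrite gmonM !galg_lift_gmon rmorphM fM -!mulrA; congr (_ * _).
by rewrite !mulrA; congr (_ * _); apply: phiC.
Qed.

End GroupAlgebraExtension.

Section GroupAlgebraMap.
Variables (R : comNzRingType) (G H : groupType) (f : G -> H).

Definition galg_map (u : galg R G) : galg R H :=
  \sum_(g <- msupp u) gmon (mcoeff g u) (f g).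

Hypothesis f1 : f 1%g = 1%g.
Hypothesis fM : {morph f : g h / (g * h)%g}.

Lemma galg_mapE u : galg_map u =
  galg_lift (GRing.in_alg (galg R H)) (fun g => gbasis R (f g)) u.
Proof.
apply: eq_bigr => g _ /=.
by rewrite -scalerAl mul1r gmonZ mulr1.
Qed.

Lemma galg_map_gmon x g : galg_map (gmon x g) = gmon x (f g).
Proof.
by rewrite galg_mapE galg_lift_gmon /= -scalerAl mul1r gmonZ mulr1.
Qed.

Lemma galg_map_linear : linear galg_map.
Proof.
move=> x u v; rewrite !galg_mapE raddfD /=; congr (_ + _).
elim/galg_ind: u => [|u u' IH IH'|y g]; first by rewrite !(scaler0, raddf0).
  by rewrite !(scalerDr, raddfD) /= IH IH'.
by rewrite gmonZ !galg_lift_gmon /= -!scalerAl scalerA.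
Qed.

Lemma galg_map_monoid : monoid_morphism galg_map.
Proof.
have [h1 hM] : monoid_morphism
    (galg_lift (GRing.in_alg (galg R H)) (fun g => gbasis R (f g))).
  apply: galg_lift_monoid => [|g h|x v]; first by rewrite f1.
  - by rewrite fM gbasisM.
  - by rewrite /GRing.comm /= -scalerAl -scalerAr mul1r mulr1.
by split=> [|u v]; rewrite !galg_mapE.
Qed.

End GroupAlgebraMap.

Section QuotientAlgebra.
Variables (K : comNzRingType) (A : algType K) (S : A -> Prop).

Inductive ideal_gen : A -> Prop :=
| ideal_gen_mem u : S u -> ideal_gen u
| ideal_gen0 : ideal_gen 0
| ideal_genD u v : ideal_gen u -> ideal_gen v -> ideal_gen (u + v)
| ideal_genMl u v : ideal_gen v -> ideal_gen (u * v)
| ideal_genMr u v : ideal_gen u -> ideal_gen (u * v).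

Definition ideal_genb : {pred A} := fun u => `[< ideal_gen u >].

Lemma ideal_genbP u : reflect (ideal_gen u) (u \in ideal_genb).
Proof. exact: asboolP. Qed.

Lemma ideal_genb_zmod : zmod_closed ideal_genb.
Proof.
split=> [|u v /ideal_genbP hu /ideal_genbP hv]; apply/ideal_genbP.
  exact: ideal_gen0.
by apply: ideal_genD => //; rewrite -mulN1r; apply: ideal_genMl.
Qed.

HB.instance Definition _ := GRing.isZmodClosed.Build A ideal_genb ideal_genb_zmod.

Definition quot_alg : Type := Quotient.quot ideal_genb.
HB.instance Definition _ := EqQuotient.on quot_alg.
HB.instance Definition _ := GRing.Zmodule.on quot_alg.

Definition quot_pi (u : A) : quot_alg := \pi_quot_alg u.

Lemma quot_piP u v : quot_pi u = quot_pi v <-> ideal_gen (u - v).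
Proof.
rewrite /quot_pi; split=> [/eqP|/ideal_genbP].
  by rewrite -Quotient.idealrBE => /ideal_genbP.
by rewrite Quotient.idealrBE => /eqP.
Qed.

Lemma quot_reprP u : ideal_gen (repr (quot_pi u) - u).
Proof. by apply/quot_piP; rewrite /quot_pi reprK. Qed.

Lemma quot_algW (P : quot_alg -> Prop) :
  (forall u, P (quot_pi u)) -> forall q, P q.
Proof. exact: quotW. Qed.

Lemma quot_pi_zmod : zmod_morphism quot_pi.
Proof.
move=> u v; rewrite /quot_pi.
exact: (raddfB (\pi_(Quotient.quot ideal_genb))).
Qed.

HB.instance Definition _ :=
  GRing.isZmodMorphism.Build A quot_alg quot_pi quot_pi_zmod.

End QuotientAlgebra.

HB.lock Definition quot_scale (K : comNzRingType) (A : algType K)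
  (S : A -> Prop) (x : K) (q : quot_alg S) : quot_alg S :=
  quot_pi S (x *: repr q).
HB.lock Definition quot_mul (K : comNzRingType) (A : algType K)
  (S : A -> Prop) (p q : quot_alg S) : quot_alg S :=
  quot_pi S (repr p * repr q).

Section QuotientAlgebraTheory.
Variables (K : comNzRingType) (A : algType K) (S : A -> Prop).

Local Notation quot_alg := (quot_alg S).
Local Notation quot_pi := (quot_pi S).
Local Notation quot_scale := (@quot_scale K A S).
Local Notation quot_mul := (@quot_mul K A S).
Local Notation ideal_gen := (ideal_gen S).

Lemma quot_pi_scale x u : quot_scale x (quot_pi u) = quot_pi (x *: u).
Proof.
rewrite quot_scale.unlock; apply/quot_piP; rewrite -scalerBr -mulr_algl.
exact/ideal_genMl/quot_reprP.
Qed.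

Lemma quot_pi_mul u v : quot_mul (quot_pi u) (quot_pi v) = quot_pi (u * v).
Proof.
rewrite quot_mul.unlock; apply/quot_piP; set u' := repr _; set v' := repr _.
have -> : u' * v' - u * v = (u' - u) * v' + u * (v' - v).
  by rewrite mulrBl mulrBr addrA addrNK.
by apply: ideal_genD; [apply: ideal_genMr|apply: ideal_genMl]; apply: quot_reprP.
Qed.

Lemma quot_scaleA x y q : quot_scale x (quot_scale y q) = quot_scale (x * y) q.
Proof. by elim/quot_algW: q => u; rewrite !quot_pi_scale scalerA. Qed.

Lemma quot_scale1 : left_id 1 quot_scale.
Proof. by elim/quot_algW => u; rewrite !quot_pi_scale scale1r. Qed.

Lemma quot_scaleDr : right_distributive quot_scale +%R.
Proof.
move=> x; elim/quot_algW => u; elim/quot_algW => v.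
by rewrite -raddfD !quot_pi_scale scalerDr raddfD.
Qed.

Lemma quot_scaleDl q : {morph quot_scale^~ q : x y / x + y}.
Proof.
by move=> x y; elim/quot_algW: q => u; rewrite !quot_pi_scale scalerDl raddfD.
Qed.

HB.instance Definition _ := GRing.Zmodule_isLmodule.Build K quot_alg
  quot_scaleA quot_scale1 quot_scaleDr quot_scaleDl.

Lemma quot_mulA : associative quot_mul.
Proof.
by elim/quot_algW => u; elim/quot_algW => v; elim/quot_algW => w;
  rewrite !quot_pi_mul mulrA.
Qed.

Lemma quot_mul1q : left_id (quot_pi 1) quot_mul.
Proof. by elim/quot_algW => u; rewrite quot_pi_mul mul1r. Qed.

Lemma quot_mulq1 : right_id (quot_pi 1) quot_mul.
Proof. by elim/quot_algW => u; rewrite quot_pi_mul mulr1. Qed.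

Lemma quot_mulDl : left_distributive quot_mul +%R.
Proof.
elim/quot_algW => u; elim/quot_algW => v; elim/quot_algW => w.
by rewrite -raddfD !quot_pi_mul mulrDl raddfD.
Qed.

Lemma quot_mulDr : right_distributive quot_mul +%R.
Proof.
elim/quot_algW => u; elim/quot_algW => v; elim/quot_algW => w.
by rewrite -raddfD !quot_pi_mul mulrDr raddfD.
Qed.

HB.instance Definition _ := GRing.Zmodule_isPzRing.Build quot_alg
  quot_mulA quot_mul1q quot_mulq1 quot_mulDl quot_mulDr.

Lemma quot_pi_monoid : monoid_morphism quot_pi.
Proof. by split=> // u v; rewrite -quot_pi_mul. Qed.

HB.instance Definition _ :=
  GRing.isMonoidMorphism.Build A quot_alg quot_pi quot_pi_monoid.

Lemma quot_pi_scalable : scalable quot_pi.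
Proof. by move=> x u; rewrite -quot_pi_scale. Qed.

HB.instance Definition _ :=
  GRing.isScalable.Build K A quot_alg *:%R quot_pi quot_pi_scalable.

Lemma quot_scalerAl (x : K) (p q : quot_alg) : x *: (p * q) = (x *: p) * q.
Proof.
elim/quot_algW: p => u; elim/quot_algW: q => v.
by rewrite -rmorphM -!linearZ -rmorphM /= scalerAl.
Qed.

Lemma quot_scalerAr (x : K) (p q : quot_alg) : x *: (p * q) = p * (x *: q).
Proof.
elim/quot_algW: p => u; elim/quot_algW: q => v.
by rewrite -rmorphM -!linearZ -rmorphM /= scalerAr.
Qed.

End QuotientAlgebraTheory.

Notation braid_alg n := (galg Rabc (braid n)).

Definition cubic_rel (n : nat) (u : braid_alg n) : Prop :=
  exists i : 'I_n.-1, let s := gbasis Rabc (braid_gen i) in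
    u = (s - Ra%:A) * (s - Rb%:A) * (s - Rc%:A).

Definition Hecke (n : nat) := quot_alg (@cubic_rel n).
HB.instance Definition _ n := GRing.Lmodule.on (Hecke n).
HB.instance Definition _ n := GRing.PzRing.on (Hecke n).

Definition Hecke_pi (n : nat) (u : braid_alg n) : Hecke n :=
  quot_pi (@cubic_rel n) u.

Section HeckeNontrivial.
Variable n : nat.

(* The character of B_n sending every s_i to a. *)
Definition braid_char_letter (l : 'I_n.-1 * bool) : Qabc_frac :=
  if l.2 then val Ra else (val Ra)^-1.

Definition braid_char (g : braid n) : Qabc_frac :=
  \prod_(l <- repr g) braid_char_letter l.

Lemma Ra_neq0 : val Ra != 0.
Proof.
rewrite Ra.unlock; apply/eqP=> /= h; have /eqP := abc_frac_neq0; apply.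
rewrite /abc_frac big_ord_recl.
by rewrite (_ : ord0 = inord 0) ?h ?mul0r //; apply/val_inj; rewrite /= inordK.
Qed.

Lemma braid_char_pi (u : word 'I_n.-1) :
  braid_char (\pi u) = \prod_(l <- u) braid_char_letter l.
Proof.
rewrite /braid_char; have := pres_reprK (@braid_rel n) u.
move: (repr _) => w; elim=> {u w}
  [u|u v _ ->|u v w _ -> _ ->|u u' v v' _ h _ h'|i e|u v] //.
- by rewrite !big_cat /= h h'.
- rewrite !big_cons big_nil mulr1 /braid_char_letter /=.
  by case: e => /=; rewrite ?mulVf ?mulfV ?Ra_neq0.
- by case=> i j _; rewrite /gword /= !big_cons.
Qed.

Lemma braid_charM : {morph braid_char : g h / (g * h)%g >-> g * h}.
Proof.
elim/quotW=> u; elim/quotW=> v.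
by rewrite -[(_ * _)%g]pi_pres_cat !braid_char_pi big_cat.
Qed.

Lemma braid_char1 : braid_char 1%g = 1.
Proof. by rewrite [LHS]braid_char_pi big_nil. Qed.

Definition braid_alg_char (u : braid_alg n) : Qabc_frac :=
  galg_lift (val : Rabc -> Qabc_frac) braid_char u.

Lemma braid_alg_char_monoid : monoid_morphism braid_alg_char.
Proof.
apply: galg_lift_monoid; [exact: braid_char1 | exact: braid_charM |].
by move=> x s; apply: mulrC.
Qed.

Lemma braid_alg_char_ideal u : ideal_gen (@cubic_rel n) u -> braid_alg_char u = 0.
Proof.
have [h1 hM] := braid_alg_char_monoid.
elim=> {u} [u [i ->]||u v _ h _ h'|u v _ h|u v _ h].
- rewrite !hM [X in X * _ * _](_ : _ = 0) ?mul0r //.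
  rewrite /braid_alg_char raddfB /= galg_lift_gmon rmorph1 mul1r.
  rewrite [X in X - _]braid_char_pi big_seq1 /=.
  rewrite -gbasis1 gmonZ mulr1 galg_lift_gmon braid_char1 mulr1.
  by rewrite /braid_char_letter subrr.
- exact: raddf0.
- by rewrite /braid_alg_char raddfD /= -!/(braid_alg_char _) h h' addr0.
- by rewrite hM h mulr0.
- by rewrite hM h mul0r.
Qed.

Lemma Hecke_oner_neq0 : (1 : Hecke n) != 0.
Proof.
apply/eqP => h; have /quot_piP : quot_pi (@cubic_rel n) 1 = quot_pi _ 0.
  by rewrite raddf0.
rewrite subr0 => /braid_alg_char_ideal.
by have [-> _] := braid_alg_char_monoid => /eqP; rewrite oner_eq0.
Qed.

End HeckeNontrivial.

HB.instance Definition _ n :=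
  GRing.PzSemiRing_isNonZero.Build (Hecke n) (Hecke_oner_neq0 n).
HB.instance Definition _ n :=
  GRing.Lmodule_isLalgebra.Build Rabc (Hecke n) (@quot_scalerAl _ _ _).
HB.instance Definition _ n :=
  GRing.Lalgebra_isAlgebra.Build Rabc (Hecke n) (@quot_scalerAr _ _ _).
HB.instance Definition _ n := GRing.isZmodMorphism.Build
  (braid_alg n) (Hecke n) (@Hecke_pi n) (@quot_pi_zmod _ _ _).
HB.instance Definition _ n := GRing.isMonoidMorphism.Build
  (braid_alg n) (Hecke n) (@Hecke_pi n) (@quot_pi_monoid _ _ _).
HB.instance Definition _ n := GRing.isScalable.Build Rabc
  (braid_alg n) (Hecke n) *:%R (@Hecke_pi n) (@quot_pi_scalable _ _ _).
HB.instance Definition _ n := EqQuotient.on (Hecke n).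

HB.lock Definition Hecke_gen (n : nat) (i : 'I_n.-1) : Hecke n :=
  Hecke_pi (gbasis Rabc (braid_gen i)).
HB.lock Definition Hecke_genV (n : nat) (i : 'I_n.-1) : Hecke n :=
  Hecke_pi (gbasis Rabc (braid_gen i)^-1%g).

Lemma Hecke_genVP n (i : 'I_n.-1) :
  Hecke_gen i * Hecke_genV i = 1 /\ Hecke_genV i * Hecke_gen i = 1.
Proof.
rewrite Hecke_gen.unlock Hecke_genV.unlock -!rmorphM /= -!gbasisM.
by rewrite mulgV mulVg gbasis1 rmorph1.
Qed.

Lemma Hecke_braid3 n (i j : 'I_n.-1) : j = i.+1 :> nat ->
  Hecke_gen i * Hecke_gen j * Hecke_gen i
  = Hecke_gen j * Hecke_gen i * Hecke_gen j.
Proof.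
by move=> ij; rewrite Hecke_gen.unlock -!rmorphM /= -!gbasisM (braid_rel3P ij).
Qed.

Lemma Hecke_cubic n (i : 'I_n.-1) :
  (Hecke_gen i - Ra%:A) * (Hecke_gen i - Rb%:A) * (Hecke_gen i - Rc%:A) = 0.
Proof.
set s := gbasis Rabc (braid_gen i).
have P c : Hecke_pi (c%:A : braid_alg n) = c%:A :> Hecke n.
  by rewrite linearZ /= rmorph1.
have E c : Hecke_gen i - c%:A = Hecke_pi (s - c%:A) by rewrite Hecke_gen.unlock -P -raddfB.
have M (u v : braid_alg n) : Hecke_pi u * Hecke_pi v = Hecke_pi (u * v).
  by rewrite rmorphM.
rewrite !E !M; have -> : 0 = Hecke_pi (0 : braid_alg n) by rewrite raddf0.
by apply/quot_piP; rewrite subr0; apply: ideal_gen_mem; exists i.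
Qed.

Section HeckeWiden.
Variables (m n : nat) (le_mn : (m <= n)%N).

Definition Hecke_widen (h : Hecke m) : Hecke n :=
  Hecke_pi (galg_map (braid_widen le_mn) (repr h)).

Let wmap : braid_alg m -> braid_alg n := galg_map (braid_widen le_mn).

Let wmapD : {morph wmap : u v / u + v}.
Proof.
by move=> u v; rewrite -[u]scale1r [LHS]galg_map_linear !scale1r.
Qed.

Let wmapZ x : {morph wmap : u / x *: u}.
Proof.
move=> u; have w0 : wmap 0 = 0.
  by apply: (addrI (wmap 0)); rewrite -wmapD !addr0.
have /= := galg_map_linear (braid_widen le_mn) x u 0.
by rewrite -!/(wmap _) w0 !addr0.
Qed.

Let wmap_monoid : monoid_morphism wmap.
Proof. exact: (galg_map_monoid _ (braid_widen1 _) (braid_widenM _)). Qed.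

Lemma Hecke_widen_pi u :
  Hecke_widen (Hecke_pi u) = Hecke_pi (galg_map (braid_widen le_mn) u).
Proof.
apply/quot_piP; have := quot_reprP (@cubic_rel m) u.
rewrite -/(Hecke_pi u) -!/(wmap _); move: (repr _) => v.
have wN w : wmap (- w) = - wmap w by rewrite -!scaleN1r wmapZ.
rewrite -wN -wmapD; move: (v - u) => {u v} w.
have [w1 wM] := wmap_monoid.
elim=> {w} [w [i ->]||u v _ h _ h'|u v _ h|u v _ h].
- apply: ideal_gen_mem; exists (widen_ord (leq_pred2 le_mn) i) => /=.
  rewrite !wM !wmapD !wN !wmapZ w1.
  by rewrite [wmap (gbasis _ _)]galg_map_gmon braid_widen_gen.
- by rewrite -[X in wmap X](scale0r (0 : braid_alg m)) wmapZ scale0r; apply: ideal_gen0.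
- by rewrite wmapD; apply: ideal_genD.
- by rewrite wM; apply: ideal_genMl.
- by rewrite wM; apply: ideal_genMr.
Qed.

Lemma Hecke_widen_gen i :
  Hecke_widen (Hecke_gen i) = Hecke_gen (widen_ord (leq_pred2 le_mn) i).
Proof.
by rewrite !Hecke_gen.unlock Hecke_widen_pi galg_map_gmon braid_widen_gen.
Qed.

Lemma Hecke_widen_linear : linear Hecke_widen.
Proof.
move=> x; elim/quot_algW => u; elim/quot_algW => v.
rewrite -!/(Hecke_pi _) -linearZ -raddfD !Hecke_widen_pi.
by rewrite -linearZ -raddfD -!/(wmap _) wmapD wmapZ.
Qed.

Lemma Hecke_widen_monoid : monoid_morphism Hecke_widen.
Proof.
have [w1 wM] := wmap_monoid; split.
  by rewrite -(rmorph1 (@Hecke_pi m)) Hecke_widen_pi [galg_map _ _]w1 rmorph1.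
elim/quot_algW => u; elim/quot_algW => v.
by rewrite -!/(Hecke_pi _) -rmorphM !Hecke_widen_pi [galg_map _ _]wM rmorphM.
Qed.

HB.instance Definition _ :=
  GRing.isLinear.Build Rabc (Hecke m) (Hecke n) *:%R Hecke_widen
    Hecke_widen_linear.
HB.instance Definition _ :=
  GRing.isMonoidMorphism.Build (Hecke m) (Hecke n) Hecke_widen
    Hecke_widen_monoid.

End HeckeWiden.

Definition s1 : Hecke 3 := @Hecke_gen 3 (ord0 : 'I_2).
Definition s2 : Hecke 3 := @Hecke_gen 3 (ord_max : 'I_2).
Definition s1V : Hecke 3 := @Hecke_genV 3 (ord0 : 'I_2).
Definition s2V : Hecke 3 := @Hecke_genV 3 (ord_max : 'I_2).

Definition BMW_rel1 : Hecke 3 :=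
  - (Ry *: (s1 * s2V * s1)) + Ry ^+ 2 *: (s2V * s1 * s2V) - s1 * s2 * s1
  - (Rx * Ry ^+ 2) *: s2V ^+ 2 + Rx *: s1 ^+ 2
  + Ry ^+ 3 *: (s2V * s1V * s2V).

Definition BMW3 := quot_alg (fun u : Hecke 3 => u = BMW_rel1).
HB.instance Definition _ := GRing.Lmodule.on BMW3.
HB.instance Definition _ := GRing.PzRing.on BMW3.

Definition BMW3_pi (u : Hecke 3) : BMW3 := quot_pi _ u.

Definition Hecke23 : Hecke 2 -> Hecke 3 := Hecke_widen (leqnSn 2).

Section Traces.
Variable M : lmodType Rabc.

Definition is_MT3 (t : {linear Hecke 3 -> M}) : Prop :=
  (forall u v : Hecke 3, t (u * v) = t (v * u)) /\
  (forall u : Hecke 3, (exists w : Hecke 2, u = Hecke23 w) ->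
     t (u * s2) = t (u * s2V)).

Definition factors_BMW3 (t : {linear Hecke 3 -> M}) : Prop :=
  exists t' : {linear BMW3 -> M}, forall u, t u = t' (BMW3_pi u).

Definition determined_by (t : {linear Hecke 3 -> M})
    (us : seq (Hecke 3)) : Prop :=
  forall t' : {linear Hecke 3 -> M}, is_MT3 t' -> factors_BMW3 t' ->
    (forall u, u \in us -> t' u = t u) -> t' =1 t.

End Traces.

Definition invertible_in (r : Rabc) (M : lmodType Rabc) : Prop :=
  bijective (fun m : M => r *: m).

(* Main.v *)
(* Write g, h for the two generators, G, H for their inverses, and let L be the
   span of 1, g, G. The braid relations rewrite h g^e H and H G H, and the
   relation R_1 rewrites H g H, so that modulo R_1 the module
   L + L h L + L H L is stable under right multiplication by H, hence by h
   thanks to the cubic relation, and is the whole algebra. A trace d with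
   d (u h) = d (u H) for u in L is then known from e = d 1, s = d g, which is
   also d G, d h and d H, and p = d (g h), which is also d (g H), d (G h) and
   d (G H). Expanding d (R_1 h) = 0 and d (R_1) = 0 gives x (a^2 - y^2) s in K p
   and x^2 (a^2 - y) e in K s + K p. *)
Require Import Defs.
From mathcomp Require Import all_boot all_order all_algebra.
From mathcomp Require Import ring.

Set Implicit Arguments.
Unset Strict Implicit.
Unset Printing Implicit Defensive.

Import GRing.Theory.
Local Open Scope ring_scope.
Local Open Scope quotient_scope.

(** * Quadratic rewriting rules from a cubic relation *)

Section CubicInverse.
Variables (K : comNzRingType) (A : algType K).

(** The identity is proved in the commutative ring K[X] and then evaluated at [s]. The coefficients
    are grouped so that [b] and [c] enter only through [b + c] and [b * c]. *)
Lemma cubic_expand (s : A) (a b c : K) :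
  (s - a%:A) * (s - b%:A) * (s - c%:A)
  = s ^+ 3 - (a + (b + c)) *: s ^+ 2 + (a * (b + c) + b * c) *: s
    - (a * (b * c))%:A.
Proof.
have E : ('X - a%:P) * ('X - b%:P) * ('X - c%:P)
  = 'X^3 - (a + (b + c))%:P * 'X^2 + (a * (b + c) + b * c)%:P * 'X
    - (a * (b * c))%:P :> {poly K} by rewrite !rmorphM !rmorphD /= !rmorphM; ring.
have /= := congr1 (horner_alg s) E.
rewrite !(rmorphM, rmorphB, rmorphD) /= ?rmorphXn /= !horner_algX !horner_algC.
move=> ->; rewrite -!scalerDl -!scalerAl !mul1r !scalerA -scalerDl.
by rewrite -!scalerAl !mul1r -expr2 -exprS (mulrA a).
Qed.

Variables (s V : A) (e1 e2 e3 i : K).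
Hypotheses (sV : s * V = 1) (e3i : e3 * i = 1).
Hypothesis cubic_s : s ^+ 3 - e1 *: s ^+ 2 + e2 *: s - e3%:A = 0.

Lemma cubic_sqr : s * s = e1 *: s - e2%:A + e3 *: V.
Proof.
have := congr1 (fun u => u * V) cubic_s.
rewrite mul0r !(mulrDl, mulNr) -!scalerAl !exprSr expr0 !mul1r.
rewrite -!mulrA sV !mulr1 => /eqP.
by rewrite subr_eq0 => /eqP <-; rewrite (addrC (_ - _)) !addrA addrAC addrK subrK.
Qed.

(** This is [cubic_sqr] times [V], divided by [e3]. *)
Lemma cubic_sqrV : V * V = i *: s - (i * e1)%:A + (i * e2) *: V.
Proof.
have := congr1 (fun u => i *: (u * V)) cubic_sqr.
rewrite !(mulrDl, mulNr) -!scalerAl !mul1r -mulrA sV mulr1.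
rewrite !(scalerDr, scalerN) !scalerA (mulrC i e3) e3i scale1r => ->.
rewrite [_ - _ + V * V]addrAC [RHS]addrAC subrK.
by rewrite addrAC subrr add0r.
Qed.

End CubicInverse.

Section CubicPair.
Variables (K : comNzRingType) (A : algType K) (a x y i j : K) (g h G H : A).
Hypotheses (ayi : a * y * i = 1) (yj : y * j = 1).
Hypotheses (gG : g * G = 1) (Gg : G * g = 1) (hH : h * H = 1) (Hh : H * h = 1).
Hypothesis ghg : g * h * g = h * g * h.
(** Elementary symmetric functions of a, b, c, with [x] standing for b + c and [y] for bc. *)
Let e1 := a + x.
Let e2 := a * x + y.
Let e3 := a * y.
Hypothesis gg : g * g = e1 *: g - e2%:A + e3 *: G.
Hypothesis GG : G * G = i *: g - (i * e1)%:A + (i * e2) *: G.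
Hypothesis HH : H * H = i *: h - (i * e1)%:A + (i * e2) *: H.

Let K_gG (u : A) : u * g * G = u. Proof. by rewrite -mulrA gG mulr1. Qed.
Let K_Gg (u : A) : u * G * g = u. Proof. by rewrite -mulrA Gg mulr1. Qed.
Let K_hH (u : A) : u * h * H = u. Proof. by rewrite -mulrA hH mulr1. Qed.
Let K_Hh (u : A) : u * H * h = u. Proof. by rewrite -mulrA Hh mulr1. Qed.

(** * Identities of the braid group on three strands *)

Lemma braid_hgH : h * g * H = G * h * g.
Proof.
have -> : h * g * H = G * (g * h * g) * H by rewrite !mulrA Gg mul1r.
by rewrite ghg !mulrA K_hH.
Qed.

Lemma braid_hGH : h * G * H = G * H * g.
Proof.
(* Inserting cancelling pairs exposes [h * g * h], to which the braid relation applies. *)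
have -> : h * G * H = G * H * (h * g * h) * G * H.
  by rewrite !mulrA K_Hh Gg mul1r.
by rewrite -ghg !mulrA K_gG K_hH.
Qed.

Lemma braid_Hgh : H * g * h = g * h * G.
Proof.
have -> : g * h * G = H * (h * g * h) * G by rewrite !mulrA Hh mul1r.
by rewrite -ghg !mulrA K_gG.
Qed.

Lemma braid_HGH : H * G * H = G * H * G.
Proof.
have -> : G * H * G = H * G * H * (h * g * h) * G * H * G.
  by rewrite !mulrA !(K_Hh, K_Gg) Hh mul1r.
by rewrite -ghg !mulrA !(K_gG, K_hH).
Qed.

(** * The relation R_1 and a spanning set modulo it *)

Definition bmw_rel : A :=
  - (y *: (g * H * g)) + y ^+ 2 *: (H * g * H) - g * h * g
  - (x * y ^+ 2) *: H ^+ 2 + x *: g ^+ 2 + y ^+ 3 *: (H * G * H).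

Lemma bmw_rel_HgH : y ^+ 2 *: (H * g * H) = bmw_rel - y ^+ 3 *: (H * G * H)
  - x *: g ^+ 2 + (x * y ^+ 2) *: H ^+ 2 + g * h * g + y *: (g * H * g).
Proof. by rewrite /bmw_rel !addrK !subrK addrAC addNr add0r. Qed.

(** The module L, which the cubic relation makes the subalgebra generated by [g] and [G]. *)
Definition pow_span (u : A) : Prop :=
  exists c0 c1 c2 : K, u = c0%:A + c1 *: g + c2 *: G.

Lemma pow_spanD u v : pow_span u -> pow_span v -> pow_span (u + v).
Proof.
move=> [c0 [c1 [c2 ->]]] [c0' [c1' [c2' ->]]].
exists (c0 + c0'), (c1 + c1'), (c2 + c2').
by rewrite addrACA [X in X + _]addrACA !scalerDl.
Qed.

Lemma pow_spanZ c u : pow_span u -> pow_span (c *: u).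
Proof.
move=> [c0 [c1 [c2 ->]]]; exists (c * c0), (c * c1), (c * c2).
by rewrite !scalerDr !scalerA.
Qed.

Lemma pow_span1 : pow_span 1.
Proof. by exists 1, 0, 0; rewrite !scale0r !addr0 scale1r. Qed.

Lemma pow_spang : pow_span g.
Proof. by exists 0, 1, 0; rewrite !scale0r scale1r addr0 add0r. Qed.

Lemma pow_spanG : pow_span G.
Proof. by exists 0, 0, 1; rewrite !scale0r scale1r !add0r. Qed.

Lemma pow_span_gg : pow_span (g * g).
Proof. by exists (- e2), e1, e3; rewrite gg scaleNr (addrC (- _)). Qed.

Lemma pow_span_GG : pow_span (G * G).
Proof. by exists (- (i * e1)), i, (i * e2); rewrite GG scaleNr (addrC (- _)). Qed.

Lemma pow_span_mulg u : pow_span u -> pow_span (u * g).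
Proof.
move=> [c0 [c1 [c2 ->]]]; rewrite !mulrDl -!scalerAl mul1r Gg.
by apply: pow_spanD; [apply: pow_spanD|]; apply: pow_spanZ;
  [apply: pow_spang|apply: pow_span_gg|apply: pow_span1].
Qed.

Lemma pow_span_mulG u : pow_span u -> pow_span (u * G).
Proof.
move=> [c0 [c1 [c2 ->]]]; rewrite !mulrDl -!scalerAl mul1r gG.
by apply: pow_spanD; [apply: pow_spanD|]; apply: pow_spanZ;
  [apply: pow_spanG|apply: pow_span1|apply: pow_span_GG].
Qed.

Lemma pow_span_mul u v : pow_span u -> pow_span v -> pow_span (u * v).
Proof.
move=> lu [c0 [c1 [c2 ->]]]; rewrite !mulrDr -!scalerAr mulr1.
by apply: pow_spanD; [apply: pow_spanD|]; apply: pow_spanZ => //;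
  [apply: pow_span_mulg|apply: pow_span_mulG].
Qed.

(** The ideal generated by [bmw_rel] is included, so that reductions modulo R_1 take place in [A]
    itself. *)
Inductive bmw_span : A -> Prop :=
| bmw_span_rel u v : bmw_span (u * bmw_rel * v)
| bmw_span_low v : pow_span v -> bmw_span v
| bmw_span_pos v w : pow_span v -> pow_span w -> bmw_span (v * h * w)
| bmw_span_neg v w : pow_span v -> pow_span w -> bmw_span (v * H * w)
| bmw_spanD u v : bmw_span u -> bmw_span v -> bmw_span (u + v)
| bmw_spanZ c u : bmw_span u -> bmw_span (c *: u).

Lemma bmw_spanN u : bmw_span u -> bmw_span (- u).
Proof. by rewrite -scaleN1r; apply: bmw_spanZ. Qed.

Lemma bmw_span_mul_pow u w : pow_span w -> bmw_span u -> bmw_span (u * w).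
Proof.
move=> lw; elim=> {u} [u v|v lv|v v' lv lv'|v v' lv lv'|u v _ IHu _ IHv|c u _ IHu].
- by rewrite -mulrA; apply: bmw_span_rel.
- exact/bmw_span_low/pow_span_mul.
- by rewrite -mulrA; apply: bmw_span_pos => //; apply: pow_span_mul.
- by rewrite -mulrA; apply: bmw_span_neg => //; apply: pow_span_mul.
- by rewrite mulrDl; apply: bmw_spanD.
- by rewrite -scalerAl; apply: bmw_spanZ.
Qed.

Lemma bmw_span_pow_mul u w : pow_span w -> bmw_span u -> bmw_span (w * u).
Proof.
move=> lw; elim=> {u} [u v|v lv|v v' lv lv'|v v' lv lv'|u v _ IHu _ IHv|c u _ IHu].
- by rewrite !mulrA; apply: bmw_span_rel.
- exact/bmw_span_low/pow_span_mul.
- by rewrite !mulrA; apply: bmw_span_pos => //; apply: pow_span_mul.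
- by rewrite !mulrA; apply: bmw_span_neg => //; apply: pow_span_mul.
- by rewrite mulrDr; apply: bmw_spanD.
- by rewrite -scalerAr; apply: bmw_spanZ.
Qed.

Lemma bmw_span1 : bmw_span 1. Proof. exact/bmw_span_low/pow_span1. Qed.

Lemma bmw_span_h : bmw_span h.
Proof. by rewrite -[h]mulr1 -[h]mul1r; apply: bmw_span_pos pow_span1 pow_span1. Qed.

Lemma bmw_span_H : bmw_span H.
Proof. by rewrite -[H]mulr1 -[H]mul1r; apply: bmw_span_neg pow_span1 pow_span1. Qed.

Lemma bmw_span_HH : bmw_span (H * H).
Proof.
rewrite HH; apply: bmw_spanD; last exact/bmw_spanZ/bmw_span_H.
apply: bmw_spanD; first exact/bmw_spanZ/bmw_span_h.
exact/bmw_spanN/bmw_spanZ/bmw_span1.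
Qed.

(** In [H * w * H], the case [w = 1] falls to the cubic relation and [w = G] to [braid_HGH]. For
    [w = g], R_1 is solved for the word by means of the inverse [j] of [y]. *)
Lemma bmw_span_HgH : bmw_span (H * g * H).
Proof.
have -> : H * g * H = j ^+ 2 *: (y ^+ 2 *: (H * g * H)).
  by rewrite scalerA -exprMn mulrC yj expr1n scale1r.
apply: bmw_spanZ; rewrite bmw_rel_HgH.
(* [bmw_rel] must not be unfolded into a sum by [apply: bmw_spanD]. *)
have := bmw_span_rel 1 1; rewrite mul1r mulr1; move: bmw_rel => r sr.
do !apply: bmw_spanD.
- exact: sr.
- by rewrite braid_HGH; apply/bmw_spanN/bmw_spanZ/bmw_span_neg; apply: pow_spanG.
- exact/bmw_spanN/bmw_spanZ/bmw_span_low/pow_span_gg.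
- exact/bmw_spanZ/bmw_span_HH.
- by apply: bmw_span_pos; apply: pow_spang.
- by apply/bmw_spanZ/bmw_span_neg; apply: pow_spang.
Qed.

(** Left factors from L can be set aside, which leaves [h * w * H] and [H * w * H] with [w] among
    [1], [g], [G]. *)
Lemma bmw_span_mulH u : bmw_span u -> bmw_span (u * H).
Proof.
elim=> {u} [u v|v lv|v w lv [c0 [c1 [c2 ->]]]|v w lv [c0 [c1 [c2 ->]]]
  |u v _ IHu _ IHv|c u _ IHu].
- by rewrite -mulrA; apply: bmw_span_rel.
- by rewrite -[H]mulr1 mulrA; apply: bmw_span_neg pow_span1.
- rewrite -!mulrA; apply: bmw_span_pow_mul => //.
  rewrite mulrDl mulrDl !mulrDr -!scalerAl -!scalerAr mul1r hH !mulrA.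
  rewrite braid_hgH braid_hGH; do !apply: bmw_spanD; apply: bmw_spanZ.
  + exact: bmw_span1.
  + by apply: bmw_span_pos; [apply: pow_spanG|apply: pow_spang].
  + by apply: bmw_span_neg; [apply: pow_spanG|apply: pow_spang].
- rewrite -!mulrA; apply: bmw_span_pow_mul => //.
  rewrite mulrDl mulrDl !mulrDr -!scalerAl -!scalerAr mul1r !mulrA.
  rewrite braid_HGH; do !apply: bmw_spanD; apply: bmw_spanZ.
  + exact: bmw_span_HH.
  + exact: bmw_span_HgH.
  + by apply: bmw_span_neg; apply: pow_spanG.
- by rewrite mulrDl; apply: bmw_spanD.
- by rewrite -scalerAl; apply: bmw_spanZ.
Qed.

(* The cubic relation makes [h] a combination of [1], [H] and [H ^+ 2]. *)
Lemma bmw_span_mulh u : bmw_span u -> bmw_span (u * h).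
Proof.
move=> su; have -> : h = e3 *: (H * H) + e1%:A - e2 *: H.
  rewrite HH !(scalerDr, scalerN) !scalerA !mulrA [e3 * i]ayi !mul1r scale1r.
  by rewrite [RHS]addrAC addrK subrK.
rewrite !mulrDr mulrN -!scalerAr mulr1 mulrA.
do !apply: bmw_spanD; last apply: bmw_spanN; apply: bmw_spanZ => //.
  by do 2!apply: bmw_span_mulH.
exact: bmw_span_mulH.
Qed.

(** * Traces vanishing on the ideal of R_1 *)

Variables (M : lmodType K) (d : {linear A -> M}).
Hypothesis dC : forall u v, d (u * v) = d (v * u).
Hypothesis dlow : forall u, pow_span u -> d (u * h) = d (u * H).
Hypothesis dR : forall u v, d (u * bmw_rel * v) = 0.

(** The two generators are conjugate by [g * h]. *)
Lemma trace_gen : d g = d h.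
Proof.
have -> : h = (g * h) * g * (H * G) by rewrite ghg !mulrA K_hH K_gG.
by rewrite dC !mulrA K_Gg Hh mul1r.
Qed.

Lemma trace_H : d H = d g.
Proof. by have := dlow pow_span1; rewrite !mul1r trace_gen. Qed.

Lemma trace_G : d G = d g.
Proof.
rewrite -trace_H.
have -> : H = (g * h) * G * (H * G).
  by rewrite -braid_Hgh !mulrA K_hH K_gG.
by rewrite dC !mulrA K_Gg Hh mul1r.
Qed.

Lemma trace_gH : d (g * H) = d (g * h).
Proof. exact/esym/dlow/pow_spang. Qed.

Lemma trace_Gh : d (G * h) = d (g * h).
Proof.
rewrite -trace_gH dC.
have ghgg : g * h * g * g = h * h * g * h.
  by rewrite ghg -!mulrA; congr (_ * _); rewrite !mulrA ghg.
(* Conjugation by the half twist [g * h * g], whose inverse is [G * H * G], exchanges [g] and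
   [h]. *)
have -> : h * G = (g * h * g) * (g * H) * (G * H * G).
  by rewrite !mulrA ghgg !(K_hH, K_gG).
by rewrite dC !mulrA !(K_Gg, K_Hh) Gg mul1r.
Qed.

Lemma trace_GH : d (G * H) = d (g * h).
Proof. by rewrite -(dlow pow_spanG) trace_Gh. Qed.

Lemma trace_pow_span_mulh_eq0 u : d g = 0 -> d (g * h) = 0 -> pow_span u -> d (u * h) = 0.
Proof.
move=> dg dgh [c0 [c1 [c2 ->]]].
rewrite !mulrDl -!scalerAl mul1r !linearD !linearZ /= -trace_gen trace_Gh dg dgh.
by rewrite !scaler0 !addr0.
Qed.

Lemma trace_span_eq0 u : d 1 = 0 -> d g = 0 -> d (g * h) = 0 ->
  bmw_span u -> d u = 0.
Proof.
move=> d1 dg dgh; elim=> {u} [u v|v [c0 [c1 [c2 ->]]]|v w lv lw|v w lv lw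
  |u v _ IHu _ IHv|c u _ IHu].
- exact: dR.
- by rewrite !linearD !linearZ /= trace_G d1 dg !scaler0 !addr0.
(* Cyclicity gathers both factors from L on the left of [h]. *)
- by rewrite dC mulrA; apply: trace_pow_span_mulh_eq0 => //; apply: pow_span_mul.
- by rewrite dC mulrA -dlow; [apply: trace_pow_span_mulh_eq0 => //|]; apply: pow_span_mul.
- by rewrite linearD /= IHu IHv addr0.
- by rewrite linearZ /= IHu scaler0.
Qed.

Lemma trace_ggh : d (g * g * h) = e1 *: d (g * h) - e2 *: d g + e3 *: d (g * h).
Proof.
rewrite gg !mulrDl mulNr -!scalerAl mul1r !linearD linearN !linearZ /=.
by rewrite -trace_gen trace_Gh.
Qed.

Lemma trace_gggh : d (g * g * g * h) =
  e1 *: d (g * g * h) - e2 *: d (g * h) + e3 *: d g.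
Proof.
rewrite -(mulrA g g g) {1}gg !mulrDr mulrN -!scalerAr mulr1 gG.
by rewrite !mulrDl mulNr -!scalerAl mul1r !linearD linearN !linearZ /= -trace_gen.
Qed.

(** In [bmw_rel * h] the factor [h] cancels a trailing [H] in three terms. Once [d (g * h) = 0],
    only multiples of [d g] remain. *)
Lemma trace_gen_mul_eq0 : d (g * h) = 0 -> (x * (a ^+ 2 - y ^+ 2)) *: d g = 0.
Proof.
move=> dgh; have dggh : d (g * g * h) = - (e2 *: d g).
  by rewrite trace_ggh dgh !scaler0 add0r addr0.
have gHgh : d (g * H * g * h) = 0.
  by rewrite -!mulrA (mulrA H) braid_Hgh dC K_Gg.
have ghgh : d (g * h * g * h) = - ((e1 * e2 - e3) *: d g).
  have -> : g * h * g * h = (g * g * h) * g by rewrite -!mulrA (mulrA h) -ghg !mulrA.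
  rewrite dC !mulrA trace_gggh dggh dgh scaler0 subr0 scalerN scalerA.
  by rewrite scalerBl opprB addrC.
have := dR 1 h; rewrite mul1r /bmw_rel !expr2 !(mulrDl, mulNr) -!scalerAl.
rewrite !K_Hh !linearD !linearN !linearZ /= gHgh ghgh dggh (dC H g) (dC H G).
rewrite trace_gH trace_GH trace_H dgh.
rewrite !(scalerN, scaler0, oppr0, add0r, addr0, opprK) scalerA -!scalerBl.
move=> <-; congr (_ *: _).
(* The collected coefficient is e1 e2 - e3 - x y^2 - x e2. *)
by rewrite /e1 /e2 /e3; ring.
Qed.

(** In [d bmw_rel] only [H ^+ 2] and [g ^+ 2] contribute, through the constant terms of [HH] and
    [gg]. *)
Lemma trace_one_mul_eq0 : d g = 0 -> d (g * h) = 0 ->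
  (x ^+ 2 * (a ^+ 2 - y)) *: d 1 = 0.
Proof.
move=> dg dgh.
have low0 u : pow_span u -> d (u * H) = 0.
  by move=> lu; rewrite -dlow //; apply: trace_pow_span_mulh_eq0.
have gHg : d (g * H * g) = 0 by rewrite dC mulrA; apply/low0/pow_span_gg.
have ghg0 : d (g * h * g) = 0.
  by rewrite dC mulrA; apply: trace_pow_span_mulh_eq0 => //; apply: pow_span_gg.
have HGH : d (H * G * H) = 0.
  by rewrite braid_HGH dC mulrA; apply/low0/pow_span_GG.
have HgH : d (H * g * H) = 0.
  rewrite dC mulrA HH !mulrDl mulNr -!scalerAl mul1r !linearD linearN !linearZ /=.
  by rewrite (dC h) (dC H) trace_gH dgh dg !(scaler0, oppr0, addr0).
have dHH : d (H * H) = - ((i * e1) *: d 1).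
  by rewrite HH !linearD linearN !linearZ /= trace_H -trace_gen dg !scaler0 add0r addr0.
have dgg : d (g * g) = - (e2 *: d 1).
  by rewrite gg !linearD linearN !linearZ /= trace_G dg !scaler0 add0r addr0.
have := dR 1 1; rewrite mul1r mulr1 /bmw_rel !expr2 !linearD !linearN !linearZ /=.
rewrite gHg ghg0 HGH HgH dHH dgg.
rewrite !(scalerN, scaler0, oppr0, add0r, addr0, opprK) !scalerA -scalerBl.
(* The factor [- a] clears the inverse [i] of [a * y] coming from [HH], and fixes the sign. *)
move=> /(congr1 (fun m => - a *: m)).
rewrite scaler0 scalerA => <-; congr (_ *: _).
have -> : - a * (x * (y * y) * (i * e1) - x * e2)
  = a * x * e2 - (a * y * i) * x * y * e1 by ring.
by rewrite ayi /e1 /e2; ring.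
Qed.

End CubicPair.

(** * Generators of the cubic Hecke algebra *)

Section HeckeGenerators.
Variable n : nat.

(** The group algebra is spanned by words in the generators and their inverses, and a word is built
    by appending letters on the right. *)
Lemma Hecke_gen_ind (P : Hecke n -> Prop) :
  P 1 -> (forall u v, P u -> P v -> P (u + v)) -> (forall c u, P u -> P (c *: u)) ->
  (forall u k, P u -> P (u * Hecke_gen k)) ->
  (forall u k, P u -> P (u * Hecke_genV k)) -> forall u, P u.
Proof.
move=> P1 PD PZ Pgen PgenV; elim/quot_algW; rewrite -/(Hecke_pi _).
elim/galg_ind => [|u v|c].
- have -> : quot_pi (@cubic_rel n) 0 = 0 *: (1 : Hecke n) by rewrite scale0r raddf0.
  exact: PZ.
- by rewrite raddfD; apply: PD.
elim/quotW => w; have -> : quot_pi (@cubic_rel n) (gmon c (\pi_(braid n) w))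
    = c *: Hecke_pi (gbasis Rabc (\pi_(braid n) w)).
  by rewrite -linearZ /= gmonZ mulr1.
apply: PZ; elim/last_ind: w => [|w [k e] IH].
  by rewrite [gbasis _ _]gbasis1 rmorph1.
rewrite -cats1 pi_pres_cat gbasisM rmorphM /=.
case: e.
  by have := Pgen _ k IH; rewrite Hecke_gen.unlock.
by have := PgenV _ k IH; rewrite Hecke_genV.unlock pres_genV.
Qed.

Lemma Hecke_gen_sqr (k : 'I_n.-1) : Hecke_gen k * Hecke_gen k
  = (Ra + Rx) *: Hecke_gen k - (Ra * Rx + Ry)%:A + (Ra * Ry) *: Hecke_genV k.
Proof.
have := Hecke_cubic k; rewrite cubic_expand; apply: cubic_sqr.
by have [] := Hecke_genVP k.
Qed.

Lemma Rabc_invE : Ra * Ry * Rabc_inv = 1.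
Proof. by rewrite mulrA Rabc_invP. Qed.

Lemma Hecke_genV_sqr (k : 'I_n.-1) : Hecke_genV k * Hecke_genV k
  = Rabc_inv *: Hecke_gen k - (Rabc_inv * (Ra + Rx))%:A
    + (Rabc_inv * (Ra * Rx + Ry)) *: Hecke_genV k.
Proof.
have := Hecke_cubic k; rewrite cubic_expand.
by apply: cubic_sqrV Rabc_invE; have [] := Hecke_genVP k.
Qed.

End HeckeGenerators.

Lemma Hecke_widen_genV m n (le_mn : (m <= n)%N) (k : 'I_m.-1) :
  Hecke_widen le_mn (Hecke_genV k) = Hecke_genV (widen_ord (leq_pred2 le_mn) k).
Proof.
rewrite Hecke_genV.unlock Hecke_widen_pi galg_map_gmon !pres_genV.
by rewrite braid_widen_pi.
Qed.

(** This carries the trace condition, imposed on the image of H_2, over to L: the single generator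
    of H_2 goes to [s1]. *)
Lemma Hecke23_pow_span u : pow_span s1 s1V u -> exists w, u = Hecke23 w.
Proof.
move=> [c0 [c1 [c2 ->]]].
exists (c0%:A + c1 *: @Hecke_gen 2 ord0 + c2 *: @Hecke_genV 2 ord0).
rewrite /Hecke23 !linearD !linearZ /= rmorph1 Hecke_widen_gen Hecke_widen_genV.
by congr (_ + _ *: Hecke_gen _ + _ *: Hecke_genV _); apply: val_inj.
Qed.

(** * Specialisation to [g = s1] and [h = s2] *)

Section BMWTrace.
Variables (M : lmodType Rabc).

(** Vanishing on the ideal of R_1 is the form of factorization that passes at once to a difference
    of traces. *)
Lemma factors_BMW3_ideal (t : {linear Hecke 3 -> M}) u v :
  factors_BMW3 t -> t (u * BMW_rel1 * v) = 0.
Proof.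
move=> [t' tE]; rewrite -(linear0 t) !tE; congr (t' _).
apply/quot_piP; rewrite subr0; apply: ideal_genMr; apply: ideal_genMl.
exact: ideal_gen_mem.
Qed.

Variable d : {linear Hecke 3 -> M}.
Hypothesis d_MT3 : is_MT3 d.
Hypothesis d_BMW : forall u v, d (u * BMW_rel1 * v) = 0.

Let gG : s1 * s1V = 1. Proof. by have [] := Hecke_genVP (ord0 : 'I_(3.-1)). Qed.
Let Gg : s1V * s1 = 1. Proof. by have [] := Hecke_genVP (ord0 : 'I_(3.-1)). Qed.
Let hH : s2 * s2V = 1. Proof. by have [] := Hecke_genVP (ord_max : 'I_(3.-1)). Qed.
Let Hh : s2V * s2 = 1. Proof. by have [] := Hecke_genVP (ord_max : 'I_(3.-1)). Qed.
Let ghg : s1 * s2 * s1 = s2 * s1 * s2. Proof. exact: Hecke_braid3. Qed.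
Let gg := Hecke_gen_sqr (ord0 : 'I_(3.-1)).
Let GG := Hecke_genV_sqr (ord0 : 'I_(3.-1)).
Let HH := Hecke_genV_sqr (ord_max : 'I_(3.-1)).
Let dC u v : d (u * v) = d (v * u). Proof. by case: d_MT3. Qed.
Let dlow u : pow_span s1 s1V u -> d (u * s2) = d (u * s2V).
Proof. by move/Hecke23_pow_span; case: d_MT3 => _; apply. Qed.
(** The inverse of bc is a (abc)^-1. *)
Let yj : Ry * (Ra * Rabc_inv) = 1.
Proof. by rewrite mulrA (mulrC Ry) Rabc_invE. Qed.

Lemma Hecke3_bmw_span u : bmw_span Rx Ry s1 s2 s1V s2V u.
Proof.
elim/Hecke_gen_ind: u => [|u v|c u|u k su|u k su].
- exact: bmw_span1.
- exact: bmw_spanD.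
- exact: bmw_spanZ.
(* An index of ['I_2] is [ord0], giving [s1], or [ord_max], giving [s2]. *)
- case: (unliftP ord0 k) => [k' ->|->]; last first.
    exact: (bmw_span_mul_pow gG Gg gg GG (pow_spang _ _)).
  have -> : lift ord0 k' = ord_max :> 'I_(3.-1) by apply: val_inj; rewrite /= ord1.
  exact: (bmw_span_mulh Rabc_invE yj gG Gg hH Hh ghg gg GG HH).
- case: (unliftP ord0 k) => [k' ->|->]; last first.
    exact: (bmw_span_mul_pow gG Gg gg GG (pow_spanG _ _)).
  have -> : lift ord0 k' = ord_max :> 'I_(3.-1) by apply: val_inj; rewrite /= ord1.
  exact: (bmw_span_mulH yj gG Gg hH Hh ghg gg GG HH).
Qed.

Lemma MT3_s1_s2 : d s1 = d s2.
Proof. exact: (trace_gen gG Gg hH Hh ghg dC). Qed.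

Lemma BMW3_trace_eq0 u : d 1 = 0 -> d s1 = 0 -> d (s1 * s2) = 0 -> d u = 0.
Proof.
move=> d1 ds ds12.
exact: (trace_span_eq0 gG Gg hH Hh ghg gg GG dC dlow d_BMW d1 ds ds12
  (Hecke3_bmw_span u)).
Qed.

Lemma BMW3_trace_s1 : d (s1 * s2) = 0 -> (Rx * (Ra ^+ 2 - Ry ^+ 2)) *: d s1 = 0.
Proof. exact: (trace_gen_mul_eq0 gG Gg hH Hh ghg gg dC dlow d_BMW). Qed.

Lemma BMW3_trace_1 : d s1 = 0 -> d (s1 * s2) = 0 ->
  (Rx ^+ 2 * (Ra ^+ 2 - Ry)) *: d 1 = 0.
Proof.
exact: (trace_one_mul_eq0 Rabc_invE gG Gg hH Hh ghg gg GG HH dC dlow d_BMW).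
Qed.

End BMWTrace.

(** * From vanishing of a trace to uniqueness *)

Lemma invertible_in_eq0 r (M : lmodType Rabc) (m : M) :
  invertible_in r M -> r *: m = 0 -> m = 0.
Proof. by move=> /bij_inj r_inj rm; apply: r_inj; rewrite scaler0. Qed.

(** Both conditions pass to the difference [t' - t], so uniqueness becomes the vanishing of a single
    trace [d] that kills [us]. *)
Lemma determined_by_eq0 (M : lmodType Rabc) (t : {linear Hecke 3 -> M})
    (us : seq (Hecke 3)) :
  is_MT3 t -> factors_BMW3 t ->
  (forall d : {linear Hecke 3 -> M}, is_MT3 d ->
     (forall u v, d (u * BMW_rel1 * v) = 0) ->
     (forall u, u \in us -> d u = 0) -> forall u, d u = 0) ->
  determined_by t us.
Proof.
move=> [tC tL] tB H t' [t'C t'L] t'B tt' u.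
apply/eqP; rewrite -subr_eq0; apply/eqP.
apply: (H (GRing.sub_fun t' t : {linear Hecke 3 -> M})) => [|u' v'|u' us_u'] /=.
- split=> [u' v'|u' Hu'] /=; first by rewrite t'C tC.
  by rewrite t'L // tL.
- by rewrite !factors_BMW3_ideal // subrr.
- by rewrite tt' // subrr.
Qed.

Theorem proposition5p5 (M : lmodType Rabc) (t : {linear Hecke 3 -> M})
    (t_MT3 : is_MT3 t) (t_BMW3 : factors_BMW3 t) :
  [/\ t s1 = t s2 /\ determined_by t [:: 1; s1; s1 * s2],
      invertible_in (Rx * (Ra ^+ 2 - Ry ^+ 2)) M ->
        determined_by t [:: 1; s1 * s2],
      invertible_in (Rx ^+ 2 * (Ra ^+ 2 - Ry)) M ->
        determined_by t [:: s1; s1 * s2]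
    & invertible_in (Rx * (Ra ^+ 2 - Ry ^+ 2)) M ->
      invertible_in (Rx ^+ 2 * (Ra ^+ 2 - Ry)) M ->
        determined_by t [:: s1 * s2]].
Proof.
split; first split; first exact: MT3_s1_s2.
- apply: determined_by_eq0 => // d dT dB d0 u.
  by apply: BMW3_trace_eq0; rewrite // d0 // !inE eqxx ?orbT.
- move=> inv_s; apply: determined_by_eq0 => // d dT dB d0 u.
  have d12 : d (s1 * s2) = 0 by rewrite d0 // !inE eqxx orbT.
  apply: BMW3_trace_eq0 => //; first by rewrite d0 // !inE eqxx.
  exact/(invertible_in_eq0 inv_s)/BMW3_trace_s1.
- move=> inv_1; apply: determined_by_eq0 => // d dT dB d0 u.
  have ds : d s1 = 0 by rewrite d0 // !inE eqxx.
  have d12 : d (s1 * s2) = 0 by rewrite d0 // !inE eqxx orbT.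
  apply: BMW3_trace_eq0 => //.
  exact/(invertible_in_eq0 inv_1)/BMW3_trace_1.
- move=> inv_s inv_1; apply: determined_by_eq0 => // d dT dB d0 u.
  have d12 : d (s1 * s2) = 0 by rewrite d0 // !inE eqxx.
  (* [d s1] comes before [d 1], since [BMW3_trace_1] presupposes [d s1 = 0]. *)
  have ds : d s1 = 0 by exact/(invertible_in_eq0 inv_s)/BMW3_trace_s1.
  apply: BMW3_trace_eq0 => //.
  exact/(invertible_in_eq0 inv_1)/BMW3_trace_1.
Qed.
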